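(* Let $\mathbb{F}$ be a field of characteristic 0. (1) In every dendriform dialgebra over $\mathbb{F}$, the pre-Lie product $a\cdot b = a\prec b - b\succ a$ satisfies the right-symmetric identity $(a\cdot b)\cdot c - a\cdot(b\cdot c) \equiv (a\cdot c)\cdot b - a\cdot(c\cdot b)$. (2) Every multilinear polynomial identity of degree 3 satisfied by the pre-Lie triple products $[a,b,c]_1=(a\cdot b)\cdot c$ and $[a,b,c]_2=a\cdot(b\cdot c)$ in every dendriform dialgebra (equivalently, every element of the kernel of the expansion map $\mathcal{E}_3\colon \mathrm{TT}_3\to \mathrm{DD}_3$) follows from the ternary right-symmetric identity $$[a,b,c]_1-[a,b,c]_2\equiv[a,c,b]_1-[a,c,b]_2,$$ i.e. belongs to the $S_3$-submodule of $\mathrm{TT}_3$ generated by $[a,b,c]_1-[a,c,b]_1-[a,b,c]_2+[a,c,b]_2$.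
   Context: A dendriform dialgebra over $\mathbb{F}$ is a vector space with two bilinear operations $\prec,\succ$ satisfying, for all $x,y,z$: $(x\succ y)\prec z = x\succ(y\prec z)$; $(x\prec y)\prec z = x\prec(y\prec z)+x\prec(y\succ z)$; $x\succ(y\succ z)=(x\succ y)\succ z+(x\prec y)\succ z$. $\mathrm{DD}_n$ denotes the multilinear subspace of degree $n$ (each of $x_1,\dots,x_n$ occurring exactly once in each monomial) of the free dendriform dialgebra on $x_1,\dots,x_n$ over $\mathbb{F}$. $\mathrm{TT}_n$ ($n$ odd) denotes the multilinear subspace of degree $n$ of the free (nonassociative) algebra on $x_1,\dots,x_n$ with two trilinear operations $[x,y,z]_1,[x,y,z]_2$ and no relations. $S_n$ acts on both by permuting the variables, $\sigma\cdot x_i=x_{\sigma(i)}$. The expansion map $\mathcal{E}_n\colon\mathrm{TT}_n\to\mathrm{DD}_n$ is the linear map that replaces each occurrence of $[x,y,z]_1$ by $(x\cdot y)\cdot z$ and each occurrence of $[x,y,z]_2$ by $x\cdot(y\cdot z)$, where $x\cdot y=x\prec y-y\succ x$. The multilinear identities of degree $n$ satisfied by the pre-Lie triple products are the elements of $\ker\mathcal{E}_n$. The letters $a,b,c$ denote $x_1,x_2,x_3$. *)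

(* Defs.v *)
From HB Require Import structures.
From mathcomp Require Import all_boot all_order all_algebra all_fingroup.
From mathcomp Require Import generic_quotient ring_quotient.
From mathcomp Require Import finmap boolp.
From mathcomp Require Import monalg.

Set Implicit Arguments.
Unset Strict Implicit.
Unset Printing Implicit Defensive.

Import GRing.Theory.
Local Open Scope ring_scope.
Local Open Scope quotient_scope.

Declare Scope dend_scope.
Delimit Scope dend_scope with dend.

HB.mixin Record isDendriform (F : fieldType) D of GRing.Lmodule F D := {
  dprec : D -> D -> D;
  dsucc : D -> D -> D;
  dprec_linearl : forall y, linear (dprec^~ y);
  dprec_linearr : forall x, linear (dprec x);
  dsucc_linearl : forall y, linear (dsucc^~ y);
  dsucc_linearr : forall x, linear (dsucc x);
  dsucc_prec : forall x y z,
    dprec (dsucc x y) z = dsucc x (dprec y z);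
  dprec_prec : forall x y z,
    dprec (dprec x y) z = dprec x (dprec y z) + dprec x (dsucc y z);
  dsucc_succ : forall x y z,
    dsucc x (dsucc y z) = dsucc (dsucc x y) z + dsucc (dprec x y) z
}.

#[short(type="dendriformType")]
HB.structure Definition Dendriform (F : fieldType) :=
  {D of GRing.Lmodule F D & isDendriform F D}.

Notation "x ≺ y" := (dprec x y) (at level 40, left associativity) : dend_scope.
Notation "x ≻ y" := (dsucc x y) (at level 40, left associativity) : dend_scope.
Local Open Scope dend_scope.

Definition prelie (F : fieldType) (D : dendriformType F) (x y : D) : D :=
  x ≺ y - y ≻ x.
Notation "x • y" := (prelie x y) (at level 40, left associativity) : dend_scope.

Lemma linear_subr (F : fieldType) (U V : lmodType F) (f : U -> V) (x y : U) :
  linear f -> f (x - y) = f x - f y.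
Proof. by move=> lf; rewrite -scaleN1r addrC lf scaleN1r addrC. Qed.

Lemma linear_sumZ (F : fieldType) (U V : lmodType F) (f : U -> V) (I : Type)
    (r : seq I) (a : I -> F) (x : I -> U) :
  linear f -> f (\sum_(i <- r) a i *: x i) = \sum_(i <- r) a i *: f (x i).
Proof.
move=> lf; elim: r => [|i r IH]; last by rewrite !big_cons lf IH.
by rewrite !big_nil -[0](subrr 0) (linear_subr _ _ lf) subrr.
Qed.

(* Linear extension to the free module {malg F[K]} of a map on its basis K. *)
Section LinearExtension.
Variables (F : fieldType) (K : choiceType) (V : lmodType F).

Definition linext (f : K -> V) (p : {malg F[K]}) : V :=
  \sum_(k <- msupp p) p@_k *: f k.

Lemma linextEw (f : K -> V) (d : {fset K}) (p : {malg F[K]}) :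
  (msupp p `<=` d)%fset -> linext f p = \sum_(k <- d) p@_k *: f k.
Proof.
move=> sub; rewrite /linext (big_fset_incl _ sub) // => k _ kp.
by rewrite (mcoeff_outdom kp) scale0r.
Qed.

Lemma linext_is_linear (f : K -> V) : linear (linext f).
Proof.
move=> a p q.
pose d := (msupp p `|` msupp q)%fset.
rewrite (@linextEw f d p) ?fsubsetUl // (@linextEw f d q) ?fsubsetUr //.
rewrite (@linextEw f d); last first.
  apply: (fsubset_trans (msuppD_le _ _)); apply: fsetSU; exact: msuppZ_le.
rewrite scaler_sumr -big_split /=; apply: eq_bigr => k _.
by rewrite mcoeffD mcoeffZ scalerDl scalerA.
Qed.

HB.instance Definition _ (f : K -> V) :=
  GRing.isLinear.Build F {malg F[K]} V _ (linext f) (linext_is_linear f).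

Lemma linextU (f : K -> V) (k : K) : linext f << k >> = f k.
Proof. by rewrite /linext msuppU oner_eq0 big_seq_fset1 mcoeffUU scale1r. Qed.

Lemma linext_comp (W : lmodType F) (f : K -> V) (g : V -> W) (p : {malg F[K]}) :
  linear g -> g (linext f p) = \sum_(k <- msupp p) p@_k *: g (f k).
Proof. exact: linear_sumZ. Qed.

End LinearExtension.

Lemma linext_id (F : fieldType) (K : choiceType) (p : {malg F[K]}) :
  linext (fun k => << k >>) p = p.
Proof.
rewrite {2}[p]monalgE; apply: eq_bigr => k _.
by apply/malgP => l; rewrite mcoeffZ !mcoeffU mulr_natr.
Qed.

Lemma linext_uniq (F : fieldType) (K : choiceType) (V : lmodType F)
    (g h : {linear {malg F[K]} -> V}) :
  (forall k, g << k >> = h << k >>) -> g =1 h.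
Proof.
move=> gh p; rewrite -[p]linext_id /linext !raddf_sum; apply: eq_bigr => k _.
by rewrite [LHS]linearZ [RHS]linearZ gh.
Qed.

(* Nonassociative monomials in two binary operations. *)
Inductive dterm (n : nat) : Type :=
  | DVar of 'I_n
  | DPrec of dterm n & dterm n
  | DSucc of dterm n & dterm n.

Section DtermChoice.
Variable n : nat.

Fixpoint dterm_encode (t : dterm n) : GenTree.tree 'I_n :=
  match t with
  | DVar i => GenTree.Leaf i
  | DPrec s t => GenTree.Node 0 [:: dterm_encode s; dterm_encode t]
  | DSucc s t => GenTree.Node 1 [:: dterm_encode s; dterm_encode t]
  end.

Fixpoint dterm_decode (t : GenTree.tree 'I_n) : option (dterm n) :=
  match t with
  | GenTree.Leaf i => Some (DVar i)
  | GenTree.Node 0 [:: s; t] =>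
      if (dterm_decode s, dterm_decode t) is (Some s', Some t')
      then Some (DPrec s' t') else None
  | GenTree.Node 1 [:: s; t] =>
      if (dterm_decode s, dterm_decode t) is (Some s', Some t')
      then Some (DSucc s' t') else None
  | _ => None
  end.

Lemma dterm_encodeK : pcancel dterm_encode dterm_decode.
Proof. by elim=> //= s -> t ->. Qed.

End DtermChoice.

HB.instance Definition _ n := Choice.copy (dterm n) (pcan_type (@dterm_encodeK n)).

Fixpoint dterm_leaves n (t : dterm n) : seq 'I_n :=
  match t with
  | DVar i => [:: i]
  | DPrec s t | DSucc s t => dterm_leaves s ++ dterm_leaves t
  end.

HB.lock Definition mprec (F : fieldType) n (u v : {malg F[dterm n]}) : {malg F[dterm n]} :=
  linext (fun s => linext (fun t => << DPrec s t >> : {malg F[dterm n]}) v) u.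
HB.lock Definition msucc (F : fieldType) n (u v : {malg F[dterm n]}) : {malg F[dterm n]} :=
  linext (fun s => linext (fun t => << DSucc s t >> : {malg F[dterm n]}) v) u.
Arguments mprec {F n}.
Arguments msucc {F n}.

(* The free dendriform dialgebra on x_1, ..., x_n: the free algebra with two
   bilinear operations, modulo the ideal generated by the dendriform relations. *)
Section FreeDendriform.
Variables (F : fieldType) (n : nat).

Local Notation A := {malg F[dterm n]}.

Lemma mprecE u v :
  mprec u v = linext (fun s => linext (fun t => << DPrec s t >> : A) v) u.
Proof. by rewrite mprec.unlock. Qed.

Lemma msuccE u v :
  msucc u v = linext (fun s => linext (fun t => << DSucc s t >> : A) v) u.
Proof. by rewrite msucc.unlock. Qed.

Inductive dend_ideal : A -> Prop :=
  | DI_succ_prec u v w :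
      dend_ideal (mprec (msucc u v) w - msucc u (mprec v w))
  | DI_prec_prec u v w :
      dend_ideal (mprec (mprec u v) w - (mprec u (mprec v w) + mprec u (msucc v w)))
  | DI_succ_succ u v w :
      dend_ideal (msucc u (msucc v w) - (msucc (msucc u v) w + msucc (mprec u v) w))
  | DI_zero : dend_ideal 0
  | DI_lin (a : F) u v : dend_ideal u -> dend_ideal v -> dend_ideal (a *: u + v)
  | DI_precl u v : dend_ideal u -> dend_ideal (mprec u v)
  | DI_precr u v : dend_ideal v -> dend_ideal (mprec u v)
  | DI_succl u v : dend_ideal u -> dend_ideal (msucc u v)
  | DI_succr u v : dend_ideal v -> dend_ideal (msucc u v).

(* The quotient construction takes a boolean predicate. *)
Definition dend_idealb : {pred A} := fun u => `[< dend_ideal u >].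

Lemma dend_idealP u : reflect (dend_ideal u) (u \in dend_idealb).
Proof. exact: asboolP. Qed.

Lemma dend_idealb_zmod : zmod_closed dend_idealb.
Proof.
split=> [|u v /dend_idealP Iu /dend_idealP Iv]; apply/dend_idealP.
  exact: DI_zero.
by rewrite addrC -scaleN1r; apply: DI_lin.
Qed.

HB.instance Definition _ := GRing.isZmodClosed.Build A dend_idealb dend_idealb_zmod.

Definition FreeDend : Type := Quotient.quot dend_idealb.

HB.instance Definition _ := GRing.Zmodule.on FreeDend.

Definition dclass (u : A) : FreeDend := \pi_(Quotient.quot dend_idealb) u.

Lemma dclass_repr (x : FreeDend) : dclass (repr x) = x.
Proof. by rewrite /dclass reprK. Qed.

Lemma dclass_surj (x : FreeDend) : exists u, x = dclass u.
Proof. by exists (repr x); rewrite dclass_repr. Qed.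

Lemma dclassP u v : dclass u = dclass v <-> dend_ideal (u - v).
Proof.
split=> [/eqP | /dend_idealP uv]; last apply/eqP.
  by rewrite /dclass piE Quotient.equivE => /dend_idealP.
by rewrite /dclass piE Quotient.equivE.
Qed.

Lemma dclass_is_additive : zmod_morphism dclass.
Proof. by move=> u v; exact: raddfB. Qed.

HB.instance Definition _ :=
  GRing.isZmodMorphism.Build A FreeDend dclass dclass_is_additive.

Lemma mprec_linearl (v : A) : linear (mprec^~ v).
Proof. by move=> a u w; rewrite !mprecE linearP. Qed.

Lemma mprec_linearr (u : A) : linear (mprec u).
Proof.
move=> a v w; rewrite !mprecE /linext scaler_sumr -big_split /=.
apply: eq_bigr => s _; rewrite -/(linext _ _) linearP scalerDr.
by rewrite !scalerA [_ * a]mulrC.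
Qed.

Lemma msucc_linearl (v : A) : linear (msucc^~ v).
Proof. by move=> a u w; rewrite !msuccE linearP. Qed.

Lemma msucc_linearr (u : A) : linear (msucc u).
Proof.
move=> a v w; rewrite !msuccE /linext scaler_sumr -big_split /=.
apply: eq_bigr => s _; rewrite -/(linext _ _) linearP scalerDr.
by rewrite !scalerA [_ * a]mulrC.
Qed.

Lemma dclass_repr_ideal u : dend_ideal (repr (dclass u) - u).
Proof. by apply/dclassP; rewrite dclass_repr. Qed.

Lemma dend_idealD u v : dend_ideal u -> dend_ideal v -> dend_ideal (u + v).
Proof. by move=> Iu Iv; rewrite -[u]scale1r; apply: DI_lin. Qed.

(* The operations induced on the quotient; each is determined by its
   specification because dclass is onto, and kept opaque so that unification does
   not compute with representatives of classes. *)
Fact fd_scale_subproof :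
  {f : F -> FreeDend -> FreeDend | forall a u, f a (dclass u) = dclass (a *: u)}.
Proof.
exists (fun a x => dclass (a *: repr x)) => a u; apply/dclassP.
rewrite -scalerBr -[X in dend_ideal X]addr0.
by apply: DI_lin; [exact: dclass_repr_ideal | exact: DI_zero].
Qed.
Definition fd_scale := sval fd_scale_subproof.
Definition dclassZ : forall a u, fd_scale a (dclass u) = dclass (a *: u) :=
  svalP fd_scale_subproof.

Fact fd_prec_subproof :
  {f : FreeDend -> FreeDend -> FreeDend |
    forall u v, f (dclass u) (dclass v) = dclass (mprec u v)}.
Proof.
exists (fun x y => dclass (mprec (repr x) (repr y))) => u v.
apply/dclassP; set u' := repr _; set v' := repr _.
have -> : mprec u' v' - mprec u v = mprec (u' - u) v' + mprec u (v' - v).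
  rewrite (linear_subr _ _ (mprec_linearl v')) (linear_subr _ _ (mprec_linearr u)).
  by rewrite addrA subrK.
by apply: dend_idealD; [apply: DI_precl | apply: DI_precr]; apply: dclass_repr_ideal.
Qed.
Definition fd_prec := sval fd_prec_subproof.
Definition dclass_prec :
    forall u v, fd_prec (dclass u) (dclass v) = dclass (mprec u v) :=
  svalP fd_prec_subproof.

Fact fd_succ_subproof :
  {f : FreeDend -> FreeDend -> FreeDend |
    forall u v, f (dclass u) (dclass v) = dclass (msucc u v)}.
Proof.
exists (fun x y => dclass (msucc (repr x) (repr y))) => u v.
apply/dclassP; set u' := repr _; set v' := repr _.
have -> : msucc u' v' - msucc u v = msucc (u' - u) v' + msucc u (v' - v).
  rewrite (linear_subr _ _ (msucc_linearl v')) (linear_subr _ _ (msucc_linearr u)).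
  by rewrite addrA subrK.
by apply: dend_idealD; [apply: DI_succl | apply: DI_succr]; apply: dclass_repr_ideal.
Qed.
Definition fd_succ := sval fd_succ_subproof.
Definition dclass_succ :
    forall u v, fd_succ (dclass u) (dclass v) = dclass (msucc u v) :=
  svalP fd_succ_subproof.

Lemma fd_scaleA a b x : fd_scale a (fd_scale b x) = fd_scale (a * b) x.
Proof. by have [u ->] := dclass_surj x; rewrite !dclassZ scalerA. Qed.
Lemma fd_scale1 : left_id 1 fd_scale.
Proof. by move=> x; have [u ->] := dclass_surj x; rewrite dclassZ scale1r. Qed.
Lemma fd_scaleDr : right_distributive fd_scale +%R.
Proof.
move=> a x y; have [u ->] := dclass_surj x; have [v ->] := dclass_surj y.
by rewrite -raddfD !dclassZ scalerDr raddfD.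
Qed.
Lemma fd_scaleDl x : {morph fd_scale^~ x : a b / a + b}.
Proof.
by move=> a b; have [u ->] := dclass_surj x; rewrite !dclassZ scalerDl raddfD.
Qed.

HB.instance Definition _ := GRing.Zmodule_isLmodule.Build F FreeDend
  fd_scaleA fd_scale1 fd_scaleDr fd_scaleDl.

Lemma dclass_is_scalable : scalable dclass.
Proof. by move=> a u; rewrite -dclassZ. Qed.

HB.instance Definition _ :=
  GRing.isScalable.Build F A FreeDend _ dclass dclass_is_scalable.

Lemma dclass_lin a u v : a *: dclass u + dclass v = dclass (a *: u + v).
Proof. by rewrite [RHS]linearP. Qed.

Fact fd_prec_linearl y : linear (fd_prec^~ y).
Proof.
move=> a x z; have [u ->] := dclass_surj x; have [v ->] := dclass_surj y.
have [w ->] := dclass_surj z.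
by rewrite dclass_lin !dclass_prec mprec_linearl dclass_lin.
Qed.
Fact fd_prec_linearr x : linear (fd_prec x).
Proof.
move=> a y z; have [u ->] := dclass_surj x; have [v ->] := dclass_surj y.
have [w ->] := dclass_surj z.
by rewrite dclass_lin !dclass_prec mprec_linearr dclass_lin.
Qed.
Fact fd_succ_linearl y : linear (fd_succ^~ y).
Proof.
move=> a x z; have [u ->] := dclass_surj x; have [v ->] := dclass_surj y.
have [w ->] := dclass_surj z.
by rewrite dclass_lin !dclass_succ msucc_linearl dclass_lin.
Qed.
Fact fd_succ_linearr x : linear (fd_succ x).
Proof.
move=> a y z; have [u ->] := dclass_surj x; have [v ->] := dclass_surj y.
have [w ->] := dclass_surj z.
by rewrite dclass_lin !dclass_succ msucc_linearr dclass_lin.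
Qed.
Fact fd_succ_prec x y z : fd_prec (fd_succ x y) z = fd_succ x (fd_prec y z).
Proof.
have [u ->] := dclass_surj x; have [v ->] := dclass_surj y.
have [w ->] := dclass_surj z.
by rewrite !(dclass_prec, dclass_succ); apply/dclassP/DI_succ_prec.
Qed.
Fact fd_prec_prec x y z :
  fd_prec (fd_prec x y) z = fd_prec x (fd_prec y z) + fd_prec x (fd_succ y z).
Proof.
have [u ->] := dclass_surj x; have [v ->] := dclass_surj y.
have [w ->] := dclass_surj z.
by rewrite !(dclass_prec, dclass_succ) -raddfD; apply/dclassP/DI_prec_prec.
Qed.
Fact fd_succ_succ x y z :
  fd_succ x (fd_succ y z) = fd_succ (fd_succ x y) z + fd_succ (fd_prec x y) z.
Proof.
have [u ->] := dclass_surj x; have [v ->] := dclass_surj y.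
have [w ->] := dclass_surj z.
by rewrite !(dclass_prec, dclass_succ) -raddfD; apply/dclassP/DI_succ_succ.
Qed.

HB.instance Definition _ := isDendriform.Build F FreeDend
  fd_prec_linearl fd_prec_linearr fd_succ_linearl fd_succ_linearr
  fd_succ_prec fd_prec_prec fd_succ_succ.

Definition dgen (i : 'I_n) : FreeDend := dclass << DVar i >>.

Section Lift.
Variables (D : dendriformType F) (v : 'I_n -> D).

Fixpoint dterm_eval (t : dterm n) : D :=
  match t with
  | DVar i => v i
  | DPrec s t => dterm_eval s ≺ dterm_eval t
  | DSucc s t => dterm_eval s ≻ dterm_eval t
  end.

Lemma linext_dterm_prec p q :
  linext dterm_eval (mprec p q) = linext dterm_eval p ≺ linext dterm_eval q.
Proof.
rewrite mprecE (linext_comp _ _ (linext_is_linear _)).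
rewrite (linext_comp _ _ (dprec_linearl _)); apply: eq_bigr => s _.
rewrite (linext_comp _ _ (linext_is_linear _)) (linext_comp _ _ (dprec_linearr _)).
by congr (_ *: _); apply: eq_bigr => t _; rewrite linextU.
Qed.

Lemma linext_dterm_succ p q :
  linext dterm_eval (msucc p q) = linext dterm_eval p ≻ linext dterm_eval q.
Proof.
rewrite msuccE (linext_comp _ _ (linext_is_linear _)).
rewrite (linext_comp _ _ (dsucc_linearl _)); apply: eq_bigr => s _.
rewrite (linext_comp _ _ (linext_is_linear _)) (linext_comp _ _ (dsucc_linearr _)).
by congr (_ *: _); apply: eq_bigr => t _; rewrite linextU.
Qed.

Lemma dprec0l (y : D) : 0 ≺ y = 0.
Proof. by have := dprec_linearl y (-1) 0 0; rewrite /= scaler0 addr0 scaleN1r addNr. Qed.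
Lemma dprec0r (x : D) : x ≺ 0 = 0.
Proof. by have := dprec_linearr x (-1) 0 0; rewrite /= scaler0 addr0 scaleN1r addNr. Qed.
Lemma dsucc0l (y : D) : 0 ≻ y = 0.
Proof. by have := dsucc_linearl y (-1) 0 0; rewrite /= scaler0 addr0 scaleN1r addNr. Qed.
Lemma dsucc0r (x : D) : x ≻ 0 = 0.
Proof. by have := dsucc_linearr x (-1) 0 0; rewrite /= scaler0 addr0 scaleN1r addNr. Qed.

Lemma dend_ideal_eval p : dend_ideal p -> linext dterm_eval p = 0.
Proof.
elim=> {p} [u w z|u w z|u w z||a u w _ Hu _ Hw|u w _ H|u w _ H|u w _ H|u w _ H].
- by rewrite raddfB /= !(linext_dterm_prec, linext_dterm_succ) dsucc_prec subrr.
- by rewrite raddfB raddfD /= !(linext_dterm_prec, linext_dterm_succ) dprec_prec subrr.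
- by rewrite raddfB raddfD /= !(linext_dterm_prec, linext_dterm_succ) dsucc_succ subrr.
- by rewrite raddf0.
- by rewrite linearP /= Hu Hw scaler0 addr0.
- by rewrite linext_dterm_prec H dprec0l.
- by rewrite linext_dterm_prec H dprec0r.
- by rewrite linext_dterm_succ H dsucc0l.
- by rewrite linext_dterm_succ H dsucc0r.
Qed.

Definition dlift (x : FreeDend) : D := linext dterm_eval (repr x).

Lemma dlift_class u : dlift (dclass u) = linext dterm_eval u.
Proof.
apply/eqP; rewrite /dlift -subr_eq0; apply/eqP.
by rewrite -(linear_subr _ _ (linext_is_linear _)); apply/dend_ideal_eval/dclass_repr_ideal.
Qed.

Lemma dlift_is_linear : linear dlift.
Proof.
move=> a x y; have [p ->] := dclass_surj x; have [q ->] := dclass_surj y.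
by rewrite dclass_lin !dlift_class linext_is_linear.
Qed.

HB.instance Definition _ := GRing.isLinear.Build F FreeDend D _ dlift dlift_is_linear.

Lemma dlift_gen i : dlift (dgen i) = v i.
Proof. by rewrite dlift_class linextU. Qed.

Lemma dlift_prec x y : dlift (x ≺ y) = dlift x ≺ dlift y.
Proof.
have [p ->] := dclass_surj x; have [q ->] := dclass_surj y.
by rewrite [dclass p ≺ _]dclass_prec !dlift_class linext_dterm_prec.
Qed.

Lemma dlift_succ x y : dlift (x ≻ y) = dlift x ≻ dlift y.
Proof.
have [p ->] := dclass_surj x; have [q ->] := dclass_surj y.
by rewrite [dclass p ≻ _]dclass_succ !dlift_class linext_dterm_succ.
Qed.

Lemma dclass_prec_term s t :
  dclass << DPrec s t >> = dclass << s >> ≺ dclass << t >>.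
Proof. by rewrite [RHS]dclass_prec mprecE !linextU. Qed.

Lemma dclass_succ_term s t :
  dclass << DSucc s t >> = dclass << s >> ≻ dclass << t >>.
Proof. by rewrite [RHS]dclass_succ msuccE !linextU. Qed.

Lemma dlift_uniq (g : {linear FreeDend -> D}) :
    (forall i, g (dgen i) = v i) ->
    (forall x y, g (x ≺ y) = g x ≺ g y) ->
    (forall x y, g (x ≻ y) = g x ≻ g y) ->
  g =1 dlift.
Proof.
move=> gv gp gs x; have [p ->] := dclass_surj x.
pose h : {linear A -> D} := g \o dclass.
rewrite dlift_class -[LHS]/(h p); apply: linext_uniq => t.
rewrite /h /= linextU; elim: t => [i|s IHs t IHt|s IHs t IHt] /=; first exact: gv.
- by rewrite dclass_prec_term gp IHs IHt.
- by rewrite dclass_succ_term gs IHs IHt.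
Qed.

End Lift.

(* DD_n, as a subspace of the free dendriform dialgebra. *)
Definition DD (x : FreeDend) : Prop :=
  exists2 u : A,
    {in msupp u, forall t, perm_eq (dterm_leaves t) (enum 'I_n)} & x = dclass u.

End FreeDendriform.

(* Nonassociative monomials in two ternary operations. *)
Inductive tterm (n : nat) : Type :=
  | TVar of 'I_n
  | TBr1 of tterm n & tterm n & tterm n
  | TBr2 of tterm n & tterm n & tterm n.

Section TtermChoice.
Variable n : nat.

Fixpoint tterm_encode (t : tterm n) : GenTree.tree 'I_n :=
  match t with
  | TVar i => GenTree.Leaf i
  | TBr1 r s t => GenTree.Node 0 [:: tterm_encode r; tterm_encode s; tterm_encode t]
  | TBr2 r s t => GenTree.Node 1 [:: tterm_encode r; tterm_encode s; tterm_encode t]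
  end.

Fixpoint tterm_decode (t : GenTree.tree 'I_n) : option (tterm n) :=
  match t with
  | GenTree.Leaf i => Some (TVar i)
  | GenTree.Node 0 [:: r; s; t] =>
      if (tterm_decode r, tterm_decode s, tterm_decode t)
        is (Some r', Some s', Some t')
      then Some (TBr1 r' s' t') else None
  | GenTree.Node 1 [:: r; s; t] =>
      if (tterm_decode r, tterm_decode s, tterm_decode t)
        is (Some r', Some s', Some t')
      then Some (TBr2 r' s' t') else None
  | _ => None
  end.

Lemma tterm_encodeK : pcancel tterm_encode tterm_decode.
Proof. by elim=> //= r -> s -> t ->. Qed.

End TtermChoice.

HB.instance Definition _ n := Choice.copy (tterm n) (pcan_type (@tterm_encodeK n)).

Fixpoint tterm_leaves n (t : tterm n) : seq 'I_n :=
  match t with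
  | TVar i => [:: i]
  | TBr1 r s t | TBr2 r s t => tterm_leaves r ++ tterm_leaves s ++ tterm_leaves t
  end.

Definition tterm_multilinear n (t : tterm n) : bool :=
  perm_eq (tterm_leaves t) (enum 'I_n).

(* The underlying space of the free algebra with two trilinear operations and
   no relations: its monomials form a basis. *)
Notation FreeTriple F n := {malg F[tterm n]}.

(* TT_n, as a subspace of the free algebra. *)
Definition TT (F : fieldType) (n : nat) (p : FreeTriple F n) : Prop :=
  {in msupp p, forall t, tterm_multilinear t}.

Section Expansion.
Variables (F : fieldType) (n : nat) (D : dendriformType F).

Fixpoint tterm_eval (v : 'I_n -> D) (t : tterm n) : D :=
  match t with
  | TVar i => v i
  | TBr1 r s t => (tterm_eval v r • tterm_eval v s) • tterm_eval v t
  | TBr2 r s t => tterm_eval v r • (tterm_eval v s • tterm_eval v t)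
  end.

(* The value of p when x_i is v i and the brackets are the pre-Lie triple
   products of D. *)
Definition tt_eval (v : 'I_n -> D) (p : FreeTriple F n) : D :=
  linext (tterm_eval v) p.

End Expansion.

Definition prelie_identity (F : fieldType) (n : nat) (p : FreeTriple F n) : Prop :=
  forall (D : dendriformType F) (v : 'I_n -> D), tt_eval v p = 0.

(* The expansion map on the whole free algebra; it restricts to
   E_n : TT_n -> DD_n by expansion_TT below. *)
Definition expansion (F : fieldType) (n : nat) : FreeTriple F n -> FreeDend F n :=
  tt_eval (@dgen F n).

HB.instance Definition _ F n :=
  GRing.Linear.copy (@expansion F n) (linext (tterm_eval (@dgen F n))).

Section ExpansionTT.
Variables (F : fieldType) (n : nat).
Local Notation A := {malg F[dterm n]}.

Let graded (s : seq 'I_n) (x : FreeDend F n) :=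
  exists2 u : A, {in msupp u, forall t, perm_eq (dterm_leaves t) s} & x = dclass u.

Let graded0 s : graded s 0.
Proof. by exists 0; rewrite ?raddf0 // => t; rewrite msupp0 in_fset0. Qed.

Let gradedP s a x y : graded s x -> graded s y -> graded s (a *: x + y).
Proof.
move=> [u Hu ->] [w Hw ->]; exists (a *: u + w); rewrite ?linearP // => t.
move=> /(fsubsetP (msuppD_le _ _)); rewrite in_fsetU => /orP[|/Hw //].
by move/(fsubsetP (msuppZ_le _ _))/Hu.
Qed.

Let graded_perm s s' x : perm_eq s s' -> graded s x -> graded s' x.
Proof.
by move=> ss' [u Hu ->]; exists u => // t /Hu ts; apply: perm_trans ts ss'.
Qed.

Let graded_sum s (I : eqType) (r : seq I) (a : I -> F) (f : I -> FreeDend F n) :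
  {in r, forall i, graded s (f i)} -> graded s (\sum_(i <- r) a i *: f i).
Proof.
elim: r => [|i r IH] Hf; first by rewrite big_nil.
rewrite big_cons; apply: gradedP; first by apply: Hf; rewrite mem_head.
by apply: IH => j jr; apply: Hf; rewrite inE jr orbT.
Qed.

Let graded_term t : graded (dterm_leaves t) (dclass << t >>).
Proof. by exists << t >> => // t'; rewrite msuppU oner_eq0 in_fset1 => /eqP ->. Qed.

Let dclass_sum (u : A) : dclass u = \sum_(t <- msupp u) u@_t *: dclass << t >>.
Proof.
rewrite -[u in LHS]linext_id linext_comp //; exact: linearP.
Qed.

Let graded_op (op : FreeDend F n -> FreeDend F n -> FreeDend F n)
    (c : dterm n -> dterm n -> dterm n) s s' x y :
    (forall u w, dterm_leaves (c u w) = dterm_leaves u ++ dterm_leaves w) ->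
    (forall u w, op (dclass << u >>) (dclass << w >>) = dclass << c u w >>) ->
    (forall z, linear (op^~ z)) -> (forall z, linear (op z)) ->
  graded s x -> graded s' y -> graded (s ++ s') (op x y).
Proof.
move=> cl opE Ll Lr [u Hu ->] [w Hw ->].
rewrite (dclass_sum u) (linear_sumZ _ _ _ (Ll _)); apply: graded_sum => t tu.
rewrite (dclass_sum w) (linear_sumZ _ _ _ (Lr _)); apply: graded_sum => t' tw.
rewrite opE; apply: graded_perm (graded_term _); rewrite cl.
by apply: perm_cat; [apply: Hu | apply: Hw].
Qed.

Let graded_prelie s s' x y :
  graded s x -> graded s' y -> graded (s ++ s') (x • y).
Proof.
move=> gx gy; rewrite /prelie addrC -scaleN1r; apply: gradedP.
  apply: graded_perm (graded_op (c := @DSucc n) _ _ _ _ gy gx) => //.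
  - by rewrite perm_catC.
  - by move=> u w; rewrite dclass_succ_term.
  - exact: dsucc_linearl.
  - exact: dsucc_linearr.
apply: (graded_op (c := @DPrec n)) gx gy => //.
- by move=> u w; rewrite dclass_prec_term.
- exact: dprec_linearl.
- exact: dprec_linearr.
Qed.

Lemma expansion_TT (p : FreeTriple F n) : TT p -> DD (expansion p).
Proof.
move=> Hp; rewrite -/(graded (enum 'I_n) _); apply: graded_sum => t tp.
apply: graded_perm (Hp t tp) _.
elim: t {tp} => [i|r IHr s IHs t IHt|r IHr s IHs t IHt] /=.
- exact: (graded_term (DVar i)).
- by rewrite catA; do !apply: graded_prelie.
- by do !apply: graded_prelie.
Qed.

End ExpansionTT.

Fixpoint tterm_act n (sigma : 'S_n) (t : tterm n) : tterm n :=
  match t with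
  | TVar i => TVar (sigma i)
  | TBr1 r s t => TBr1 (tterm_act sigma r) (tterm_act sigma s) (tterm_act sigma t)
  | TBr2 r s t => TBr2 (tterm_act sigma r) (tterm_act sigma s) (tterm_act sigma t)
  end.

Definition tt_act (F : fieldType) n (sigma : 'S_n) (p : FreeTriple F n) : FreeTriple F n :=
  linext (fun t => << tterm_act sigma t >>) p.

Definition is_TT_submodule (F : fieldType) n (U : FreeTriple F n -> Prop) : Prop :=
  [/\ forall p, U p -> TT p,
      U 0,
      forall (a : F) p q, U p -> U q -> U (a *: p + q)
    & forall (sigma : 'S_n) p, U p -> U (tt_act sigma p)].

Lemma tterm_act_multilinear n (sigma : 'S_n) (t : tterm n) :
  tterm_multilinear t -> tterm_multilinear (tterm_act sigma t).
Proof.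
have -> : tterm_multilinear (tterm_act sigma t)
          = perm_eq (map sigma (tterm_leaves t)) (enum 'I_n).
  congr (perm_eq _ _); elim: t => //= r -> s -> t ->; by rewrite !map_cat.
move=> /(perm_map sigma) /perm_trans; apply.
apply: uniq_perm => [||i]; [|exact: enum_uniq|].
  by rewrite (map_inj_uniq (@perm_inj _ sigma)) enum_uniq.
rewrite mem_enum; apply/mapP; exists ((sigma^-1)%g i).
  by rewrite mem_enum.
by rewrite permKV.
Qed.

Lemma TT_submodule (F : fieldType) n : is_TT_submodule (@TT F n).
Proof.
have TT0 : @TT F n 0 by move=> t; rewrite msupp0 in_fset0.
have TTlin (a : F) (p q : FreeTriple F n) : TT p -> TT q -> TT (a *: p + q).
  move=> Hp Hq t /(fsubsetP (msuppD_le _ _)); rewrite in_fsetU => /orP[|/Hq //].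
  by move/(fsubsetP (msuppZ_le _ _))/Hp.
split=> // sigma p Hp; rewrite /tt_act /linext.
have: {in enum_fset (msupp p), forall t, tterm_multilinear t} by [].
elim: (enum_fset _) => [|t r IH] Hr; first by rewrite big_nil.
rewrite big_cons; apply: TTlin; last by apply: IH => t' tr; apply: Hr; rewrite inE tr orbT.
move=> t'; rewrite msuppU oner_eq0 in_fset1 => /eqP ->.
by apply/tterm_act_multilinear/Hr; rewrite mem_head.
Qed.

(* The S_n-submodule of TT_n generated by g, as the smallest one containing g;
   meaningful only for g in TT_n, since otherwise no U qualifies. *)
Definition TT_generated (F : fieldType) n (g p : FreeTriple F n) : Prop :=
  forall U, is_TT_submodule U -> U g -> U p.

(* a, b, c denote x_1, x_2, x_3. *)
Definition ltr_a : 'I_3 := @Ordinal 3 0 isT.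
Definition ltr_b : 'I_3 := @Ordinal 3 1 isT.
Definition ltr_c : 'I_3 := @Ordinal 3 2 isT.

Definition br1 (F : fieldType) n (i j k : 'I_n) : FreeTriple F n :=
  << TBr1 (TVar i) (TVar j) (TVar k) >>.
Definition br2 (F : fieldType) n (i j k : 'I_n) : FreeTriple F n :=
  << TBr2 (TVar i) (TVar j) (TVar k) >>.

Definition ternary_right_symmetric (F : fieldType) : FreeTriple F 3 :=
  br1 F ltr_a ltr_b ltr_c - br1 F ltr_a ltr_c ltr_b
    - br2 F ltr_a ltr_b ltr_c + br2 F ltr_a ltr_c ltr_b.

Lemma ternary_right_symmetric_TT (F : fieldType) : TT (ternary_right_symmetric F).
Proof.
have Hlin := let: And4 _ _ h _ := TT_submodule F 3 in h.
have Hmon t : tterm_multilinear t -> TT (<< t >> : FreeTriple F 3).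
  by move=> Ht t'; rewrite msuppU oner_eq0 in_fset1 => /eqP ->.
have TTD p q : TT p -> TT q -> @TT F 3 (p + q).
  by move=> Tp Tq; rewrite -[p]scale1r; apply: Hlin.
have TTB p q : TT p -> TT q -> @TT F 3 (p - q).
  by move=> Tp Tq; rewrite addrC -scaleN1r; apply: Hlin.
have Hbr (i j k : 'I_3) : uniq [:: i; j; k] -> perm_eq [:: i; j; k] (enum 'I_3).
  move=> u; apply: uniq_perm; rewrite ?enum_uniq //.
  have sub : {subset [:: i; j; k] <= enum 'I_3} by move=> l _; rewrite mem_enum.
  by have [|_] := uniq_min_size u sub; first by rewrite -cardE card_ord.
have Hbr1 (i j k : 'I_3) : uniq [:: i; j; k] -> TT (br1 F i j k).
  by move=> u; apply: (Hmon (TBr1 (TVar i) (TVar j) (TVar k))); exact: Hbr.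
have Hbr2 (i j k : 'I_3) : uniq [:: i; j; k] -> TT (br2 F i j k).
  by move=> u; apply: (Hmon (TBr2 (TVar i) (TVar j) (TVar k))); exact: Hbr.
apply: (TTD _ _ (TTB _ _ (TTB _ _ _ _) _) _).
- exact: Hbr1.
- exact: Hbr1.
- exact: Hbr2.
- exact: Hbr2.
Qed.

(* Main.v *)
(* For letters x, y, z the component spanned by the word xyz in the free
   dendriform dialgebra has the basis e_1 = x ≺ (y ≺ z), e_2 = x ≺ (y ≻ z),
   x ≻ (y ≺ z), (x ≻ y) ≻ z, (x ≺ y) ≻ z. If c_1 and c_2 are the coefficients of
   p in TT_3 on the two kinds of brackets, then the coefficients of e_1 and e_2
   in the expansion of p are c_1(xyz) + c_2(xyz) and c_1(xyz) - c_2(xzy). When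
   they vanish for all x, y, z, we get c_2 = - c_1 and c_1 is antisymmetric in
   its last two arguments, so that 2 p is the combination with coefficients
   c_1(xyz) of the translates of the ternary right-symmetric identity. The two
   coefficients are read off in an 8-dimensional nilpotent dendriform dialgebra
   in which e_1 and e_2 survive. *)
Require Import Defs.
From HB Require Import structures.
From mathcomp Require Import ssrAC all_boot all_algebra all_fingroup.
From mathcomp Require Import finmap monalg zify ring.

Set Implicit Arguments.
Unset Strict Implicit.
Unset Printing Implicit Defensive.

Import GRing.Theory.
Local Open Scope ring_scope.
Local Open Scope dend_scope.

(** * Right symmetry of the pre-Lie product *)

Section PreLie.
Variables (F : fieldType) (D : dendriformType F).
Implicit Types a b c : D.

Lemma dprecBl a b c : (a - b) ≺ c = a ≺ c - b ≺ c.
Proof. exact: (linear_subr a b (dprec_linearl c)). Qed.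

Lemma dprecBr a b c : a ≺ (b - c) = a ≺ b - a ≺ c.
Proof. exact: (linear_subr b c (dprec_linearr a)). Qed.

Lemma dsuccBl a b c : (a - b) ≻ c = a ≻ c - b ≻ c.
Proof. exact: (linear_subr a b (dsucc_linearl c)). Qed.

Lemma dsuccBr a b c : a ≻ (b - c) = a ≻ b - a ≻ c.
Proof. exact: (linear_subr b c (dsucc_linearr a)). Qed.

(** The right-hand side is visibly symmetric in [b] and [c], which yields right symmetry. *)
Lemma prelie_associator a b c :
  (a • b) • c - a • (b • c)
  = a ≺ (b ≻ c) + a ≺ (c ≻ b) - (b ≻ a) ≺ c - (c ≻ a) ≺ b
    + (c ≺ b) ≻ a + (b ≺ c) ≻ a.
Proof.
rewrite /prelie !(dprecBl, dprecBr, dsuccBl, dsuccBr).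
rewrite dprec_prec dsucc_succ -(dsucc_prec c a b) !(opprB, opprD, opprK, addrA).
(* Summands 1 and 10 are [a ≺ (b ≺ c)] with opposite signs, and 4 and 8 are [(c ≻ b) ≻ a]. *)
by rewrite [LHS](ACl ((1*10)*(4*8)*2*9*3*6*5*7)) /= !subrr !add0r.
Qed.

End PreLie.

(** * Evaluations factor through the expansion *)

Section Evaluation.
Variables (F : fieldType) (n : nat) (D : dendriformType F) (v : 'I_n -> D).

Lemma dlift_prelie x y : dlift v (x • y) = dlift v x • dlift v y.
Proof. by rewrite /prelie raddfB /= dlift_prec dlift_succ. Qed.

Lemma dlift_tterm_eval t : dlift v (tterm_eval (@dgen F n) t) = tterm_eval v t.
Proof.
elim: t => [i|r IHr s IHs t IHt|r IHr s IHs t IHt] /=; first exact: dlift_gen.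
  by rewrite !dlift_prelie IHr IHs IHt.
by rewrite !dlift_prelie IHr IHs IHt.
Qed.

Lemma dlift_expansion p : dlift v (expansion p) = tt_eval v p.
Proof.
rewrite /expansion /tt_eval (linext_comp _ _ (@dlift_is_linear _ _ _ v)).
by apply: eq_bigr => t _; rewrite dlift_tterm_eval.
Qed.

End Evaluation.

Lemma linext_reindex (F : fieldType) (K : choiceType) (V : lmodType F)
    (T : finType) (h : T -> K) (f : K -> V) (p : {malg F[K]}) :
  injective h -> {in msupp p, forall k, exists x, k = h x} ->
  linext f p = \sum_x p@_(h x) *: f (h x).
Proof.
move=> hI hp; rewrite (@linextEw _ _ _ f [fset h x | x in T]%fset p); last first.
  by apply/fsubsetP => k /hp[x ->]; apply: in_imfset.
by rewrite big_imfset /=; [rewrite big_enum | move=> x y _ _ /hI].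
Qed.

(** * The nilpotent test dialgebra *)

Section WordAlgebra.
Variable F : fieldType.

(* The coefficients of 1, 'X, ..., 'X^7 are the coordinates on the basis
   x, y, z, x ≺ y, y ≺ z, y ≻ z, x ≺ (y ≺ z), x ≺ (y ≻ z);
   note that (x ≺ y) ≺ z is the sum of the last two. *)
Definition word_algebra : Type := {poly F}.

HB.instance Definition _ := GRing.Lmodule.on word_algebra.

Implicit Types u v w : {poly F}.

(** Coefficients from ['X^8] on are neither read nor produced, so the carrier can be all of
    [{poly F}]. *)
Definition word_prec u v : {poly F} :=
  Poly [:: 0; 0; 0; u`_0 * v`_1; u`_1 * v`_2; 0;
           u`_0 * v`_4 + u`_3 * v`_2; u`_0 * v`_5 + u`_3 * v`_2].

Definition word_succ u v : {poly F} :=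
  Poly [:: 0; 0; 0; 0; 0; u`_1 * v`_2; 0; 0].

Ltac word_ring :=
  rewrite /word_prec /word_succ; apply/polyP => -[|[|[|[|[|[|[|[|k]]]]]]]];
  rewrite !(coefD, coefN, coefZ, coef_Poly) /= ?nth_nil; ring.

Fact word_prec_linearl v : linear (word_prec^~ v).
Proof. by move=> a u w; word_ring. Qed.
Fact word_prec_linearr u : linear (word_prec u).
Proof. by move=> a v w; word_ring. Qed.
Fact word_succ_linearl v : linear (word_succ^~ v).
Proof. by move=> a u w; word_ring. Qed.
Fact word_succ_linearr u : linear (word_succ u).
Proof. by move=> a v w; word_ring. Qed.
Fact word_succ_prec u v w :
  word_prec (word_succ u v) w = word_succ u (word_prec v w).
Proof. word_ring. Qed.
Fact word_prec_prec u v w :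
  word_prec (word_prec u v) w
  = word_prec u (word_prec v w) + word_prec u (word_succ v w).
Proof. word_ring. Qed.
Fact word_succ_succ u v w :
  word_succ u (word_succ v w)
  = word_succ (word_succ u v) w + word_succ (word_prec u v) w.
Proof. word_ring. Qed.

HB.instance Definition _ := isDendriform.Build F word_algebra
  word_prec_linearl word_prec_linearr word_succ_linearl word_succ_linearr
  word_succ_prec word_prec_prec word_succ_succ.

Lemma word_prelieE (u v : word_algebra) :
  u • v = Poly [:: 0; 0; 0; u`_0 * v`_1; u`_1 * v`_2; - (v`_1 * u`_2);
                   u`_0 * v`_4 + u`_3 * v`_2; u`_0 * v`_5 + u`_3 * v`_2]
  :> {poly F}.
Proof.
rewrite /prelie; change (word_prec u v - word_succ v u = Poly
  [:: 0; 0; 0; u`_0 * v`_1; u`_1 * v`_2; - (v`_1 * u`_2);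
      u`_0 * v`_4 + u`_3 * v`_2; u`_0 * v`_5 + u`_3 * v`_2] :> {poly F}).
word_ring.
Qed.

End WordAlgebra.

(** * Coordinates of the brackets in the test dialgebra *)

Section Brackets.
Variable n : nat.
Local Notation triple := ('I_n * 'I_n * 'I_n)%type.

Definition tbr1 (x : triple) : tterm n := TBr1 (TVar x.1.1) (TVar x.1.2) (TVar x.2).
Definition tbr2 (x : triple) : tterm n := TBr2 (TVar x.1.1) (TVar x.1.2) (TVar x.2).

Lemma linext_brackets (F : fieldType) (V : lmodType F) (f : tterm n -> V)
    (p : FreeTriple F n) :
  {in msupp p, forall t, exists x, t = tbr1 x \/ t = tbr2 x} ->
  linext f p
  = \sum_x p@_(tbr1 x) *: f (tbr1 x) + \sum_x p@_(tbr2 x) *: f (tbr2 x).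
Proof.
move=> suppp.
pose h (x : triple + triple) := match x with inl y => tbr1 y | inr y => tbr2 y end.
rewrite (@linext_reindex _ _ _ _ h) ?big_sumType //.
  by move=> [[[i j] k]|[[i j] k]] [[[i' j'] k']|[[i' j'] k']] //= [-> -> ->].
by move=> t /suppp[x [-> | ->]]; [exists (inl x) | exists (inr x)].
Qed.

Variables (F : fieldType) (i j k : 'I_n).

(** Each variable goes to the sum of the basis letters at the places it occupies in the word [ijk];
    [i], [j], [k] need not be distinct. *)
Definition letter (l : 'I_n) : word_algebra F :=
  Poly [:: (l == i)%:R; (l == j)%:R; (l == k)%:R].

Ltac coef_letter x :=
  case: x => [[l m] o]; rewrite !xpair_eqE -!mulnb !natrM;
  rewrite [tterm_eval _ _]/= !word_prelieE /letter !coef_Poly /=; ring.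

Lemma coef6_tbr1 x :
  (tterm_eval letter (tbr1 x) : {poly F})`_6 = (x == (i, j, k))%:R.
Proof. coef_letter x. Qed.

Lemma coef6_tbr2 x :
  (tterm_eval letter (tbr2 x) : {poly F})`_6 = (x == (i, j, k))%:R.
Proof. coef_letter x. Qed.

Lemma coef7_tbr1 x :
  (tterm_eval letter (tbr1 x) : {poly F})`_7 = (x == (i, j, k))%:R.
Proof. coef_letter x. Qed.

(** The sign and the swap come from the summand [- (o ≻ m)] of [m • o], the only part of
    [l • (m • o)] to reach this coordinate. *)
Lemma coef7_tbr2 x :
  (tterm_eval letter (tbr2 x) : {poly F})`_7 = - (x == (i, k, j))%:R.
Proof. coef_letter x. Qed.

End Brackets.

Lemma sum_delta (R : pzRingType) (T : finType) (c : T -> R) (y : T) :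
  \sum_x c x * (x == y)%:R = c y.
Proof.
rewrite (bigD1 y) //= eqxx mulr1 big1 ?addr0 // => x /negPf ->.
by rewrite mulr0.
Qed.

Lemma subrACA (V : zmodType) (a b c d : V) : a - b - c + d = a - c - (b - d).
Proof. by rewrite (addrAC a) opprB [d - b]addrC addrA. Qed.

(** * Coefficients of an identity *)

Section BracketIdentities.
Variables (F : fieldType) (n : nat) (p : FreeTriple F n).
Hypothesis suppp : {in msupp p, forall t, exists x, t = tbr1 x \/ t = tbr2 x}.
Hypothesis idp : prelie_identity p.

Lemma prelie_identity_coef2 x : p@_(tbr2 x) = - p@_(tbr1 x).
Proof.
case: x => [[i j] k].
have /(congr1 (fun u : {poly F} => u`_6)) := idp (letter F i j k).
rewrite /tt_eval linext_brackets // coefD !coef_sum coef0.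
under eq_bigr do rewrite coefZ coef6_tbr1.
under [X in _ + X]eq_bigr do rewrite coefZ coef6_tbr2.
by rewrite !sum_delta => /eqP; rewrite addrC addr_eq0 => /eqP.
Qed.

Lemma prelie_identity_coef1C i j k :
  p@_(tbr1 (i, k, j)) = - p@_(tbr1 (i, j, k)).
Proof.
have /(congr1 (fun u : {poly F} => u`_7)) := idp (letter F i j k).
rewrite /tt_eval linext_brackets // coefD !coef_sum coef0.
under eq_bigr do rewrite coefZ coef7_tbr1.
under [X in _ + X]eq_bigr do rewrite coefZ coef7_tbr2 mulrN.
rewrite sumrN !sum_delta prelie_identity_coef2 opprK addrC => /eqP.
by rewrite addr_eq0 => /eqP.
Qed.

Definition swap_last (x : 'I_n * 'I_n * 'I_n) := (x.1.1, x.2, x.1.2).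

Definition right_symmetric x : FreeTriple F n :=
  << tbr1 x >> - << tbr1 (swap_last x) >> - << tbr2 x >> + << tbr2 (swap_last x) >>.

(** Swapping the last two letters changes the sign of both the coefficient and [right_symmetric x],
    so every contribution is counted twice. *)
Lemma prelie_identity_double :
  p *+ 2 = \sum_x p@_(tbr1 x) *: right_symmetric x.
Proof.
pose m x : FreeTriple F n := << tbr1 x >> - << tbr2 x >>.
have pE : p = \sum_x p@_(tbr1 x) *: m x.
  rewrite -[LHS]linext_id linext_brackets // -big_split; apply: eq_bigr => x _ /=.
  by rewrite prelie_identity_coef2 scaleNr -scalerBr.
have swapK : involutive swap_last by case=> [[]].
have -> : \sum_x p@_(tbr1 x) *: right_symmetric x
          = \sum_x p@_(tbr1 x) *: m x - \sum_x p@_(tbr1 x) *: m (swap_last x).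
  rewrite -sumrB; apply: eq_bigr => x _; rewrite -scalerBr; congr (_ *: _).
  exact: subrACA.
rewrite [X in _ - X](reindex_inj (inv_inj swapK)) /= mulr2n {1 2}pE -sumrN.
congr (_ + _); apply: eq_bigr => -[[i j] k] _.
by rewrite swapK -scaleNr -(prelie_identity_coef1C i k j).
Qed.

End BracketIdentities.

(** * Monomials of degree 3 and the action of the symmetric group *)

Lemma size_tterm_leaves_gt0 n (t : tterm n) : (0 < size (tterm_leaves t))%N.
Proof. by elim: t => //= r Hr s _ t _; rewrite size_cat ltn_addr. Qed.

Lemma size_tterm_leaves_le1 n (t : tterm n) :
  (size (tterm_leaves t) <= 1)%N -> exists i, t = TVar i.
Proof.
case: t => [i|r s t|r s t] /=; first by exists i.
all: rewrite !size_cat.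
all: have := (size_tterm_leaves_gt0 r, size_tterm_leaves_gt0 s).
all: by case; lia.
Qed.

(** The three arguments of the outer bracket each have a leaf, so three leaves in all make each
    argument a variable. *)
Lemma tterm_degree3 n (t : tterm n) :
  size (tterm_leaves t) = 3 -> exists x, t = tbr1 x \/ t = tbr2 x.
Proof.
have bracket r s u : (size (tterm_leaves r ++ tterm_leaves s ++ tterm_leaves u) = 3)%N ->
    exists x : 'I_n * 'I_n * 'I_n, [/\ r = TVar x.1.1, s = TVar x.1.2 & u = TVar x.2].
  have r0 := size_tterm_leaves_gt0 r; have s0 := size_tterm_leaves_gt0 s.
  have u0 := size_tterm_leaves_gt0 u; rewrite !size_cat => eq3.
  have [i ri] : exists i, r = TVar i by apply: size_tterm_leaves_le1; lia.
  have [j sj] : exists j, s = TVar j by apply: size_tterm_leaves_le1; lia.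
  have [k uk] : exists k, u = TVar k by apply: size_tterm_leaves_le1; lia.
  by exists (i, j, k).
case: t => [i|r s u|r s u] //= /bracket[x [-> -> ->]]; exists x.
  by left.
by right.
Qed.

Lemma TT3_brackets (F : fieldType) (p : FreeTriple F 3) :
  TT p -> {in msupp p, forall t, exists x, t = tbr1 x \/ t = tbr2 x}.
Proof.
move=> TTp t /TTp /perm_size; rewrite -cardE card_ord; exact: tterm_degree3.
Qed.

Lemma perm_of_letters (i j k : 'I_3) : uniq [:: i; j; k] ->
  exists sigma : 'S_3, [/\ sigma ltr_a = i, sigma ltr_b = j & sigma ltr_c = k].
Proof.
move=> uijk; pose f (x : 'I_3) := nth i [:: i; j; k] x.
have fI : injective f.
  by move=> x y /eqP; rewrite nth_uniq // => /eqP/val_inj.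
by exists (perm fI); rewrite !permE.
Qed.

Lemma tt_act_is_linear (F : fieldType) n (sigma : 'S_n) :
  linear (@tt_act F n sigma).
Proof. exact: linext_is_linear. Qed.

HB.instance Definition _ (F : fieldType) n (sigma : 'S_n) :=
  GRing.isLinear.Build F (FreeTriple F n) (FreeTriple F n) _
    (@tt_act F n sigma) (tt_act_is_linear sigma).

Lemma tt_act_right_symmetric (F : fieldType) (sigma : 'S_3) :
  tt_act sigma (ternary_right_symmetric F)
  = right_symmetric F (sigma ltr_a, sigma ltr_b, sigma ltr_c).
Proof.
have actE (A B C E A' B' C' E' : FreeTriple F 3) :
    tt_act sigma A = A' -> tt_act sigma B = B' ->
    tt_act sigma C = C' -> tt_act sigma E = E' ->
  tt_act sigma (A - B - C + E) = A' - B' - C' + E'.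
  by move=> <- <- <- <-; rewrite raddfD !raddfB.
by apply: actE; exact: linextU.
Qed.

Theorem lemma4p2 (F : fieldType) (charF : [pchar F] =i pred0) :
  (forall (D : dendriformType F) (a b c : D),
     (a • b) • c - a • (b • c) = (a • c) • b - a • (c • b)) /\
  (forall p : FreeTriple F 3, TT p -> (prelie_identity p <-> expansion p = 0)) /\
  (forall p : FreeTriple F 3, TT p ->
     expansion p = 0 -> TT_generated (ternary_right_symmetric F) p).
Proof.
have expansion_identity (p : FreeTriple F 3) : prelie_identity p <-> expansion p = 0.
  (* One direction evaluates at the generators of the free dialgebra; the other uses its universal
     property. *)
  split=> [|expp D v]; first exact.
  by rewrite -dlift_expansion expp raddf0.
split=> [D a b c|]; first last.
  split=> // p TTp /expansion_identity idp U [_ U0 Ulin Uact] Ug.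
  (* Characteristic 0 enters here, to halve the formula for [p *+ 2]. *)
  have two_neq0 : 2%:R != 0 :> F by have /pcharf0P -> := charF.
  have -> : p = 2%:R^-1 *: (p *+ 2) by rewrite -scaler_nat scalerA mulVf ?scale1r.
  rewrite (prelie_identity_double (TT3_brackets TTp) idp) scaler_sumr.
  elim/big_rec: _ => [//|[[i j] k] q _ Uq]; rewrite scalerA.
  (* The sum runs over all triples, but a nonzero coefficient puts the bracket in the support of
     [p]; multilinearity then makes the letters distinct, hence a permutation. *)
  have [->|c_neq0] := eqVneq (p@_(tbr1 (i, j, k))) 0.
    by rewrite mulr0 scale0r add0r.
  apply: (Ulin) Uq.
  have [|sigma [<- <- <-]] := @perm_of_letters i j k.
    have /TTp /perm_uniq : tbr1 (i, j, k) \in msupp p by rewrite -mcoeff_neq0.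
    by rewrite enum_uniq.
  by rewrite -tt_act_right_symmetric; apply: Uact.
rewrite !prelie_associator.
by rewrite [LHS](ACl (2*1*4*3*6*5)).
Qed.
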